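(* For each $\eta\in(0,\pi/3)$, the convex hull $\mathrm{co}(K_\eta)$ of the $\eta$-dragon curve $K_\eta$ is a polygon.
   Context: For $\eta\in(0,\pi/3)$ let $a=\frac{e^{-i\eta}}{2\cos\eta}$, $f_1(z)=az$, $f_2(z)=1-\bar a z$ ($z\in\mathbb{C}$). The $\eta$-dragon curve $K_\eta$ is the unique nonempty compact set $K_\eta\subset\mathbb{C}$ with $K_\eta=f_1(K_\eta)\cup f_2(K_\eta)$. *)

(* Defs.v *)
(* R : realType, the complex plane C is modelled as R * R
   (first component = real part, second = imaginary part). *)
From HB Require Import structures.
From mathcomp Require Import all_boot all_order all_algebra.
From mathcomp Require Import all_classical all_reals all_analysis.
Set Implicit Arguments. Unset Strict Implicit. Unset Printing Implicit Defensive.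
Import Order.TTheory GRing.Theory Num.Theory.
Import numFieldNormedType.Exports.
Local Open Scope ring_scope.
Local Open Scope classical_set_scope.

Section Dragon.
Variable R : realType.

(* a = e^{-i eta} / (2 cos eta) *)
Definition dragon_a (eta : R) : R * R :=
  (cos eta / (2 * cos eta), - sin eta / (2 * cos eta)).

Definition cmul (u v : R * R) : R * R :=
  (u.1 * v.1 - u.2 * v.2, u.1 * v.2 + u.2 * v.1).
Definition cconj (u : R * R) : R * R := (u.1, - u.2).

Definition dragon_f1 (eta : R) (z : R * R) : R * R := cmul (dragon_a eta) z.
Definition dragon_f2 (eta : R) (z : R * R) : R * R :=
  let w := cmul (cconj (dragon_a eta)) z in (1 - w.1, - w.2).

Definition convex_hull (S : set (R * R)) : set (R * R) :=
  [set z | exists (n : nat) (w : 'I_n -> R) (p : 'I_n -> R * R),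
      [/\ (forall i, 0 <= w i), \sum_(i < n) w i = 1,
          (forall i, S (p i)) &
          z = (\sum_(i < n) w i * (p i).1, \sum_(i < n) w i * (p i).2)]].

Definition is_polygon (P : set (R * R)) : Prop :=
  exists s : seq (R * R), P = convex_hull [set x | x \in s].

End Dragon.

(* Main.v *)
Require Import Defs.
From HB Require Import structures.
From mathcomp Require Import all_boot all_order all_algebra.
From mathcomp Require Import all_classical all_reals all_analysis.
From mathcomp Require Import ring lra.
Import Order.TTheory GRing.Theory Num.Theory.
Import numFieldNormedType.Exports.
Local Open Scope ring_scope.
Local Open Scope classical_set_scope.

(* Write a = 1/2 - i t and q = |a|^2, so 1/4 < q < 1 and a^2 = a - q.  Let
   S_n = a^n / (1 - q^2), T_n = f2 S_n and X = f2 T_2; then S_1 is the fixed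
   point of f2 f2 f1 f1, so S_n (n >= 1), T_n (n >= 2) and X all lie in K.  The
   hull of these points is mapped into itself by f1 and f2, hence contains K;
   and since 0 is interior to the hull of the spiral S_n, and 1 to that of T_n,
   finitely many of them suffice.  Invariance is tested on linear forms u: with
   s_n = <u, S_n>, which satisfies s_(n+2) = s_(n+1) - q s_n, the images of the
   vertices are combinations of s_0, s_1, s_n.  The only delicate ones are
   f1 T_n = (1 - q^2) S_1 - q S_n: if s_1 <= s_0 this is dominated by T_(n+1),
   otherwise the recurrence bounds -s_n by q times the maximum of the form. *)

(** * Linear recurrences s_(n+2) = s_(n+1) - q s_n *)

Section Recurrence.
Variables (R : realType) (q : R).

Definition lin_rec (s : nat -> R) := forall n, s n.+2 = s n.+1 - q * s n.

Lemma lin_recS s k : lin_rec s -> lin_rec (fun n => s (n + k)%N).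
Proof. by move=> h n; rewrite !addSn h. Qed.

Lemma lin_rec_ge s b : 1 / 4 < q -> q < 1 -> lin_rec s ->
  0 <= s 0%N <= b -> 0 <= s 1%N <= b ->
  forall n, - (q * b) <= s n.
Proof.
move=> q_gt q_lt1 h /andP[s0 s0b] /andP[s1 s1b] n.
have q0 : 0 < q by lra.
have b0 : 0 <= b by lra.
have qb : 0 <= q * b by apply: mulr_ge0 => //; lra.
have qs0 : 0 <= q * s 0%N by apply: mulr_ge0 => //; lra.
have qbs : 0 <= q * (b - s 0%N) by apply: mulr_ge0; lra.
have qqb : q * (q * b) <= b.
  by rewrite mulrA ler_piMl // -expr2 expr_le1 // ltW.
suff [] : [/\ - (q * b) <= s n <= b, - (q * b) <= s n.+1 <= b &
              - (q * b) <= s n.+2 <= b] by move=> /andP[].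
elim: n => [|n [/andP[a0 c0] /andP[a1 c1] /andP[a2 c2]]].
  rewrite h; split; apply/andP; split; lra.
split; [by apply/andP|by apply/andP|].
move: a2 c2; rewrite !h => a2 c2.
have qa : 0 <= q * (s n + q * b) by apply: mulr_ge0; lra.
have qc : 0 <= q * (b - s n) by apply: mulr_ge0; lra.
(* The new term is both s_(n+2) - q s_(n+1) and (1 - q) s_(n+1) - q s_n. For either sign of s_(n+1),
   one form gives the lower bound and the other the upper one; hence the window of three terms. *)
have [y|y] := leP 0 (s n.+1).
  have := mulr_ge0 (ltW q0) y.
  have : 0 <= (1 - q) * s n.+1 by apply: mulr_ge0; lra.
  by move=> *; apply/andP; split; lra.
have : 0 <= q * - s n.+1 by apply: mulr_ge0; lra.
have : 0 <= (1 - q) * - s n.+1 by apply: mulr_ge0; lra.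
by move=> *; apply/andP; split; lra.
Qed.

(** The Lucas sequence U_n(1, q). *)
Fixpoint lin_fund n : R :=
  if n is m.+1 then if m is k.+1 then lin_fund m - q * lin_fund k else 1 else 0.

Lemma lin_fund_rec : lin_rec lin_fund. Proof. by []. Qed.

Lemma lin_recD s k n : lin_rec s ->
  s (n.+1 + k)%N = lin_fund n.+1 * s k.+1 - q * lin_fund n * s k.
Proof.
move=> h.
suff [] : s (n.+1 + k)%N = lin_fund n.+1 * s k.+1 - q * lin_fund n * s k /\
          s (n.+2 + k)%N = lin_fund n.+2 * s k.+1 - q * lin_fund n.+1 * s k by [].
elim: n => [|n [ih1 ih2]]; first by rewrite !addSn add0n h /=; split; ring.
by split=> //; rewrite !addSn h -!addSn ih1 ih2 !lin_fund_rec; ring.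
Qed.

(* The ratio of consecutive terms drops by at least [q - 1/4] at each step
   as long as the terms stay positive. *)
Lemma lin_fund_sign : 1 / 4 < q ->
  exists n, 0 < lin_fund n /\ lin_fund n.+1 <= 0.
Proof.
move=> q_gt.
apply: contrapT => /forallNP H.
have pos n : 0 < lin_fund n.+1.
  elim: n => [|n ih]; first by rewrite /=; lra.
  by rewrite ltNge; apply/negP => h; apply: (H n.+1).
have dec n : lin_fund n.+2 <= (1 - n%:R * (q - 1 / 4)) * lin_fund n.+1.
  elim: n => [|n ih]; first by rewrite /=; lra.
  set c := 1 - n%:R * (q - 1 / 4) in ih.
  have -> : 1 - n.+1%:R * (q - 1 / 4) = c - (q - 1 / 4).
    by rewrite /c -[n.+1]addn1 natrD; ring.
  have c1 : c <= 1 by rewrite /c lerBlDr lerDl mulr_ge0 //; lra.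
  have p1 := pos n; have p2 := pos n.+1.
  have c0 : 0 < c by rewrite -(pmulr_lgt0 _ p1); lra.
  rewrite lin_fund_rec -(ler_pM2l c0).
  have : c * (lin_fund n.+2 - q * lin_fund n.+1) <= c * lin_fund n.+2 - q * lin_fund n.+2.
    nra.
  (* The factor is (c - 1/2)^2 + (1 - c)(q - 1/4); its sign says 1 - q/c <= c - (q - 1/4). *)
  have : 0 <= (c ^+ 2 - c * (q - 1/4) - c + q) * lin_fund n.+2.
    apply: mulr_ge0; last exact: ltW.
    have := sqr_ge0 (c - 1 / 2).
    have : 0 <= (1 - c) * (q - 1 / 4) by apply: mulr_ge0; lra.
    lra.
  nra.
have [m mP] : exists m : nat, (q - 1 / 4)^-1 < m%:R.
  by exists (Num.bound (q - 1 / 4)^-1); apply: archi_boundP; rewrite invr_ge0; lra.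
have : 1 < m%:R * (q - 1 / 4).
  rewrite -ltr_pdivrMr; last lra.
  by rewrite [ltLHS]div1r.
have := dec m; have := pos m; have := pos m.+1.
nra.
Qed.

(** The quadratic form s_(n+1)^2 - s_n s_(n+1) + q s_n^2 is multiplied by q at each step; completing
    the square bounds it below by (q - 1/4) s_n^2. *)
Lemma lin_rec_energy s n : lin_rec s ->
  (q - 1 / 4) * s n ^+ 2 <= q ^+ n * (s 1%N ^+ 2 - s 0%N * s 1%N + q * s 0%N ^+ 2).
Proof.
move=> h.
have -> : q ^+ n * (s 1%N ^+ 2 - s 0%N * s 1%N + q * s 0%N ^+ 2) =
          s n.+1 ^+ 2 - s n * s n.+1 + q * s n ^+ 2.
  elim: n => [|n ih]; first by rewrite expr0 mul1r.
  by rewrite exprS -mulrA ih h; ring.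
have := sqr_ge0 (s n.+1 - s n / 2); nra.
Qed.

(* [0] is interior to the convex hull of a spiral, so finitely many of its
   points already span the hull. *)
Lemma lin_rec_bound : 1 / 4 < q -> q < 1 -> exists N, forall s b, lin_rec s ->
  (forall i, (i <= N)%N -> s i <= b) -> 0 <= b /\ forall n, s n <= b.
Proof.
move=> q_gt q_lt1; have [n [un un1]] := lin_fund_sign q_gt.
have q0 : 0 < q by lra.
have qun : 0 < q * lin_fund n by rewrite mulr_gt0.
(* Where U_n > 0 >= U_(n+1), [lin_recD] turns upper bounds b on s_(k+1) and s_(n+1+k) into s_k >= -
   c b. *)
pose c := (1 - lin_fund n.+1) / (q * lin_fund n).
have c0 : 0 < c by rewrite divr_gt0 //; lra.
have cE : c * (q * lin_fund n) = 1 - lin_fund n.+1 by rewrite divfK // gt_eqF.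
(* Two-sided bounds on s_0 and s_1 make the initial energy at most C b^2; from index N on, its decay
   gives s_k^2 <= b^2. *)
pose C := 3 * (1 + c) ^+ 2.
have C0 : 0 < C by rewrite mulr_gt0 // exprn_gt0 //; lra.
have [N hN] : exists N, forall k, (N <= k)%N -> q ^+ k * C <= q - 1 / 4.
  have /cvgrPdist_le/(_ ((q - 1 / 4) / C)) : (fun k => q ^+ k) @ \oo --> (0 : R).
    by apply: cvg_expr; rewrite ger0_norm //; lra.
  case=> [|N _ hN]; first by rewrite divr_gt0 //; lra.
  exists N => k Nk; rewrite -ler_pdivlMr //.
  by have := hN k Nk; rewrite /= sub0r normrN ger0_norm // exprn_ge0 //; lra.
exists (N + n.+2)%N => s b h sb.
have neg k : (k <= 1)%N -> - (c * b) <= s k.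
  move=> k1.
  have := lin_recD s k n h.
  have /sb : (n.+1 + k <= N + n.+2)%N.
    by rewrite (leq_trans _ (leq_addl _ _)) // -[n.+2]addn1 leq_add2l.
  have /sb : (k.+1 <= N + n.+2)%N.
    by rewrite (leq_trans _ (leq_addl _ _)) // (leq_trans (k1 : (k.+1 <= 2)%N)).
  move=> h1 h2 e; rewrite -(ler_pM2l qun).
  nra.
have s0 := neg 0%N isT; have s1 := neg 1%N isT.
have s0b : s 0%N <= b by apply: sb.
have s1b : s 1%N <= b by apply: sb; rewrite addnS.
have b0 : 0 <= b by nra.
split=> // k; have [kN|Nk] := leqP k (N + n.+2); first exact: sb.
have {}hN := hN k (leq_trans (leq_addr _ _) (ltnW Nk)).
have := lin_rec_energy s k h.
set E := (X in _ <= _ * X).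
have EC : E <= C * b ^+ 2.
  have B0 : 0 <= c * b by nra.
  have sq x : - (c * b) <= x -> x <= b -> x ^+ 2 <= ((1 + c) * b) ^+ 2.
    move=> x1 x2; have : 0 <= ((1 + c) * b - x) * ((1 + c) * b + x).
      by apply: mulr_ge0; lra.
    lra.
  have e0 := sq _ s0 s0b; have e1 := sq _ s1 s1b.
  have : 0 <= (1 - q) * s 0%N ^+ 2 by apply: mulr_ge0; [lra|exact: sqr_ge0].
  rewrite /E /C; have := sqr_ge0 (s 0%N + s 1%N); lra.
have qk : 0 < q ^+ k by rewrite exprn_gt0.
move=> e.
have : (q - 1 / 4) * s k ^+ 2 <= (q - 1 / 4) * b ^+ 2.
  apply: le_trans e _; apply: (@le_trans _ _ (q ^+ k * (C * b ^+ 2))).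
    by rewrite ler_pM2l.
  by rewrite mulrA ler_wpM2r // sqr_ge0.
rewrite ler_pM2l; last lra.
nra.
Qed.
(** While s_n <= 0, s_(n+2) >= s_(n+1), so the bound c persists. At the first positive term the next
    one is nonnegative too, and [lin_rec_ge] takes over. *)
Lemma lin_rec_ge_of_neg s b c : 1 / 4 < q -> q < 1 -> lin_rec s ->
  (forall n, s n <= b) -> s 0%N <= 0 -> c <= s 1%N ->
  forall n, c <= s n.+1 \/ - (q * b) <= s n.+1.
Proof.
move=> q_gt q_lt1 h sb s0 s1 n.
suff [[_ ?]|H] : (s n <= 0 /\ c <= s n.+1) \/
    forall k, (n <= k)%N -> - (q * b) <= s k.
- by left.
- by right; apply: H.
elim: n => [|n [[sn sn1]|ih]]; first by left.
  have qsn : 0 <= q * - s n by apply: mulr_ge0; lra.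
  have := h n; have [sn1_le0|sn1_gt0 hn] := leP (s n.+1) 0.
    by move=> hn; left; split=> //; lra.
  right=> k nk; rewrite -(subnK nk).
  apply: (lin_rec_ge (fun j => s (j + n.+1)%N)) => //; first exact: lin_recS.
    by rewrite sb ltW.
  by rewrite sb andbT add1n; lra.
by right=> k nk; apply: ih; rewrite ltnW.
Qed.

(* With [s n = <u, S_n>] this bounds [u] at [f1 T_(n+2)]; the last hypothesis
   bounds it at [T_(k+2)]. *)
Lemma lin_rec_corner s b n : 1 / 4 < q -> q < 1 -> lin_rec s -> 0 <= b ->
  (forall k, s k.+1 <= b) ->
  (forall k, (1 - q ^+ 2) * s 0%N - q * s k.+1 <= b) ->
  (1 - q ^+ 2) * s 1%N - q * s n.+2 <= b.
Proof.
move=> q_gt q_lt1 h b0 sb tb.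
have q2 : 0 < 1 - q ^+ 2.
  by rewrite subr_gt0 expr_lt1 //; lra.
have q0 : 0 < q by lra.
have q2b : 0 <= (1 - q ^+ 2) * b by rewrite mulr_ge0 // ltW.
have [s10|s01] := leP (s 1%N) (s 0%N).
  have : 0 <= (1 - q ^+ 2) * (s 0%N - s 1%N) by apply: mulr_ge0; lra.
  by have := tb n.+1; lra.
have h1 := h 0%N.
have hS : lin_rec (fun j => s (j + 1)%N) by exact: lin_recS.
have sbS k : s (k + 1)%N <= b by rewrite addn1.
have qs : 0 <= q * (s 1%N - s 0%N) by apply: mulr_ge0; lra.
(* Now s_0 < s_1, so s_2 >= (1 - q) s_1. For s_1 >= 0 both s_1 and s_2 lie in [0, b]; for s_1 < 0
   the constant (1 - q) s_1 serves as c. *)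
have [s1|s1] := leP 0 (s 1%N).
  have : 0 <= (1 - q) * s 1%N by apply: mulr_ge0; lra.
  move=> qs1.
  have := @lin_rec_ge (fun j => s (j + 1)%N) b q_gt q_lt1 hS.
  rewrite !add0n !add1n sb s1 sb /= => H.
  have sn : - (q * b) <= s n.+2.
    by rewrite -addn1; apply: H => //; rewrite andbT; lra.
  have : 0 <= q * (s n.+2 + q * b) by apply: mulr_ge0; lra.
  have : 0 <= (1 - q ^+ 2) * (b - s 1%N).
    by apply: mulr_ge0; [exact: ltW|rewrite subr_ge0].
  lra.
have : 0 <= (1 - q ^+ 2) * - s 1%N by apply: mulr_ge0; lra.
have s12 : (1 - q) * s 1%N <= s (1 + 1)%N by rewrite addn1; lra.
have [] := @lin_rec_ge_of_neg (fun j => s (j + 1)%N) b _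
  q_gt q_lt1 hS sbS (ltW s1) s12 n; rewrite addn1 => sn.
  have : 0 <= q * (s n.+2 - (1 - q) * s 1%N) by apply: mulr_ge0; lra.
  have : 0 <= (1 - q) * - s 1%N by apply: mulr_ge0; lra.
  lra.
have : 0 <= q * (s n.+2 + q * b) by apply: mulr_ge0; lra.
lra.
Qed.
End Recurrence.

Arguments lin_rec {R}.

(** * Convex hulls of finite sets as intersections of half-planes *)

Section HalfplaneHull.
Set Implicit Arguments.
Unset Strict Implicit.
Variable R : realType.
Implicit Types (u z : R * R) (l : seq (R * R)).

Definition dotp u z : R := u.1 * z.1 + u.2 * z.2.

Definition halfplane_hull l : set (R * R) :=
  [set z | forall u b, (forall v, v \in l -> dotp u v <= b) -> dotp u z <= b].

Lemma sub_convex_hull (A B : set (R * R)) :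
  A `<=` B -> convex_hull A `<=` convex_hull B.
Proof.
by move=> AB z [n [w [p [w0 w1 pA zE]]]]; exists n, w, p; split=> // i; apply: AB.
Qed.

Lemma convex_hull_sub_halfplane_hull l (A : set (R * R)) :
  A `<=` halfplane_hull l -> convex_hull A `<=` halfplane_hull l.
Proof.
move=> Al z [n [w [p [w0 w1 pA ->]]]] u b lb.
have -> : dotp u (\sum_(i < n) w i * (p i).1, \sum_(i < n) w i * (p i).2) =
          \sum_(i < n) w i * dotp u (p i).
  rewrite /dotp /= !mulr_sumr -big_split /=; apply: eq_bigr => i _; ring.
rewrite -[b]mul1r -w1 mulr_suml; apply: ler_sum => i _.
by apply: ler_wpM2l => //; apply: (Al _ (pA i)).
Qed.

(** Weights are row vectors here, so that [rV_compact] applies. *)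
Definition simplex n : set 'rV[R]_n :=
  [set w | (forall i, 0 <= w 0 i) /\ \sum_i w 0 i = 1].
Arguments simplex : clear implicits.

Lemma continuous_lin_comb n (c : 'I_n -> R) :
  continuous (fun w : 'rV[R]_n => \sum_i w 0 i * c i).
Proof.
apply: continuous_big => [|i _ w]; first exact: add_continuous.
apply: (@continuousM R _ (fun w : 'rV[R]_n => w 0 i) (fun=> c i)).
  exact: (@coord_continuous R 1 n 0 i w).
exact: cst_continuous.
Qed.

Lemma compact_simplex n : compact (simplex n).
Proof.
apply: (@subclosed_compact _ _
  [set w : 'rV[R]_n | forall i, `[0, 1]%classic (w 0 i)]).
- have -> : simplex n = \bigcap_(i in [set: 'I_n])
      ((fun w : 'rV[R]_n => w 0 i) @^-1` [set x | 0 <= x]) `&`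
      ((fun w : 'rV[R]_n => \sum_i w 0 i * 1) @^-1` [set 1]).
    apply/seteqP; split=> w /=.
      move=> [w0 w1]; split; first by move=> i _; apply: w0.
      by rewrite -[RHS]w1; apply: eq_bigr => i _; rewrite mulr1.
    move=> [w0 w1]; split; first by move=> i; apply: w0.
    by rewrite -[RHS]w1; apply: eq_bigr => i _; rewrite mulr1.
  apply: closedI.
    apply: closed_bigI => i _; apply: preimage_closed; last exact: closed_ge.
    by move=> w _; exact: (@coord_continuous R 1 n 0 i w).
  apply: preimage_closed; last exact: closed_eq.
  by move=> w _; exact: continuous_lin_comb.
- exact: (rV_compact (fun=> @segment_compact R 0 1)).
- move=> w [w0 w1] i /=; rewrite in_itv /= w0 -w1 (bigD1 i) //= lerDl.
  exact: sumr_ge0.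
Qed.

(* Projecting [z] on the convex hull of [l]: the halfplane bounded by the
   normal at the nearest point contains [l], hence also [z]. *)
Lemma halfplane_hull_sub_convex_hull l :
  halfplane_hull l `<=` convex_hull [set v | v \in l].
Proof.
move=> z zl.
(* For empty [l] the form u = 0 with b = -1 excludes every point. *)
have l0 : (0 < size l)%N.
  case: l zl => // zl; have := zl 0 (-1) (fun v => ltac:(by [])).
  by rewrite /dotp /= !mul0r; lra.
pose n := size l; pose p (i : 'I_n) := nth 0 l i.
pose P (w : 'rV[R]_n) : R * R :=
  (\sum_i w 0 i * (p i).1, \sum_i w 0 i * (p i).2).
pose d w := (z.1 - (P w).1) * (z.1 - (P w).1) +
            (z.2 - (P w).2) * (z.2 - (P w).2).
have cd : continuous d.
  have cB (a : R) (c : 'I_n -> R) :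
      continuous (fun w : 'rV[R]_n => a - \sum_i w 0 i * c i).
    move=> w; apply: continuousB; first exact: cst_continuous.
    exact: continuous_lin_comb.
  move=> w.
  exact: (continuousD (continuousM (cB z.1 (fst \o p) w) (cB z.1 (fst \o p) w))
                      (continuousM (cB z.2 (snd \o p) w) (cB z.2 (snd \o p) w))).
have dP (i : 'I_n) : simplex n (delta_mx 0 i).
  split=> [j|]; first by rewrite mxE ler0n.
  rewrite (bigD1 i) //= mxE !eqxx big1 ?addr0 // => j ji.
  by rewrite mxE (negbTE ji) andbF.
have [|w ws wmin] := compact_EVT_min _ (@compact_simplex n)
  (continuous_subspaceT cd).
  by exists (delta_mx 0 (Ordinal l0)).
move: ws; rewrite inE => -[w0 w1].
pose u := (z.1 - (P w).1, z.2 - (P w).2).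
have main i : dotp u (p i) <= dotp u (P w).
  pose e := ((p i).1 - (P w).1, (p i).2 - (P w).2).
  suff : dotp u e <= 0 by rewrite /dotp /=; lra.
  rewrite leNgt; apply/negP => pos.
  have e2 : 0 <= e.1 ^+ 2 + e.2 ^+ 2 by rewrite addr_ge0 // sqr_ge0.
  (* With this step length towards [p i], the squared distance changes by - (t + t^2) <u, e> < 0;
     the summand <u, e> in the denominator ensures t <= 1. *)
  pose t := dotp u e / (dotp u e + (e.1 ^+ 2 + e.2 ^+ 2)).
  have D0 : 0 < dotp u e + (e.1 ^+ 2 + e.2 ^+ 2) by lra.
  have t0 : 0 < t by rewrite divr_gt0.
  have t1 : t <= 1 by rewrite ler_pdivrMr //; lra.
  have tE : t * (dotp u e + (e.1 ^+ 2 + e.2 ^+ 2)) = dotp u e.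
    by rewrite divfK // gt_eqF.
  pose w' := (1 - t) *: w + t *: delta_mx 0 i.
  have comb (c : 'I_n -> R) :
      \sum_j w' 0 j * c j = (1 - t) * (\sum_j w 0 j * c j) + t * c i.
    rewrite mulr_sumr; under eq_bigr do rewrite !mxE mulrDl.
    rewrite big_split /=; congr (_ + _); first by apply: eq_bigr => j _; ring.
    rewrite (bigD1 i) //= !eqxx big1 ?addr0 ?mulr1 // => j ji.
    by rewrite (negbTE ji) mulr0 mul0r.
  have : d w <= d w'.
    apply: wmin; rewrite inE; split.
      move=> j; rewrite !mxE addr_ge0 // mulr_ge0 // ?ler0n ?(ltW t0) //; lra.
    have := comb (fun=> 1); rewrite mulr1.
    under eq_bigr do rewrite mulr1.
    under [X in _ = _ * X + _ -> _]eq_bigr do rewrite mulr1.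
    by move=> ->; rewrite w1; ring.
  have -> : d w' = d w - 2 * t * dotp u e + t ^+ 2 * (e.1 ^+ 2 + e.2 ^+ 2).
    by rewrite /d /P /= !comb /dotp /u /e /P /=; ring.
  have := mulr_gt0 t0 pos.
  have := mulr_gt0 t0 t0.
  nra.
have /zl : forall v, v \in l -> dotp u v <= dotp u (P w).
  move=> v vl; have vi : (index v l < n)%N by rewrite index_mem.
  by have := main (Ordinal vi); rewrite /p /= nth_index.
have hE : dotp u z - dotp u (P w) = (z.1 - (P w).1) ^+ 2 + (z.2 - (P w).2) ^+ 2.
  by rewrite /dotp /u /=; ring.
move=> h; have u1 := sqr_ge0 (z.1 - (P w).1); have u2 := sqr_ge0 (z.2 - (P w).2).
have /eqP : (z.1 - (P w).1) ^+ 2 = 0 by lra.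
rewrite sqrf_eq0 subr_eq0 => /eqP z1.
have /eqP : (z.2 - (P w).2) ^+ 2 = 0 by lra.
rewrite sqrf_eq0 subr_eq0 => /eqP z2.
exists n, (fun i => w 0 i), p; split=> //.
  by move=> i /=; apply: mem_nth.
by rewrite [z]surjective_pairing z1 z2.
Qed.
End HalfplaneHull.

(** * The two similarities and the spiral S_n *)

Section SimilarityPair.
Set Implicit Arguments.
Unset Strict Implicit.
Variables (R : realType) (t : R).
Implicit Types u z : R * R.

(* [sim1] and [sim2] are the dragon maps for [a = 1/2 - i t], and [sqratio] is
   [|a|^2]. *)
Definition sqratio : R := 1 / 4 + t ^+ 2.
Local Notation q := sqratio.

Definition sim1 z : R * R := (z.1 / 2 + t * z.2, z.2 / 2 - t * z.1).
Definition sim2 z : R * R := (1 - z.1 / 2 + t * z.2, - (z.2 / 2) - t * z.1).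
Definition sim1_adj u : R * R := (u.1 / 2 - t * u.2, u.2 / 2 + t * u.1).
Definition sim2_adj u : R * R := (- (u.1 / 2) - t * u.2, t * u.1 - u.2 / 2).

Lemma dotp_sim1 u z : dotp u (sim1 z) = dotp (sim1_adj u) z.
Proof. by rewrite /dotp /=; ring. Qed.

Lemma dotp_sim2 u z : dotp u (sim2 z) = u.1 + dotp (sim2_adj u) z.
Proof. by rewrite /dotp /=; field. Qed.

Definition spiral n : R * R := iter n sim1 ((1 - q ^+ 2)^-1, 0).

Lemma dotp_spiralS u n : dotp u (spiral n.+1) = dotp (sim1_adj u) (spiral n).
Proof. exact: dotp_sim1. Qed.

(** Cayley-Hamilton for [sim1], which has trace 1 and determinant q. *)
Lemma dotp_spiral_rec u : lin_rec q (fun n => dotp u (spiral n)).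
Proof.
by move=> n; rewrite /spiral /= /dotp /sim1 /sqratio /=; field.
Qed.

(** The linear part (- conj a)^2 a^2 = q^2 is real, so the cycle contracts along straight lines. *)
Lemma sim2_cycle z :
  sim2 (sim2 (sim1 (sim1 z))) = (1 / 2 + q ^+ 2 * z.1, - t + q ^+ 2 * z.2).
Proof. by rewrite /sim2 /sim1 /sqratio /=; congr (_, _); field. Qed.

Hypothesis qlt1 : q < 1.

Lemma sqratio2_neq0 : 1 - q ^+ 2 != 0.
Proof.
by have := qlt1; have := sqr_ge0 t; rewrite /sqratio => t0 tq;
  rewrite gt_eqF // subr_gt0 expr_lt1 //; lra.
Qed.

Lemma spiral1_eq : spiral 1 = ((1 - q ^+ 2)^-1 / 2, - t * (1 - q ^+ 2)^-1).
Proof. by rewrite /spiral /sim1 /=; congr (_, _); ring. Qed.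

(** Expresses the translation of [sim2] through S_0, leaving only terms of the sequence s_n. *)
Lemma dotp_spiral0 u : u.1 = (1 - q ^+ 2) * dotp u (spiral 0).
Proof. by rewrite /spiral /dotp /= mulr0 addr0 mulrCA mulfV ?mulr1 ?sqratio2_neq0. Qed.

(** Since a + conj a = 1, f2 z = 1 + f1 z - z. *)
Lemma dotp_sim2E u z : dotp u (sim2 z) =
  (1 - q ^+ 2) * dotp u (spiral 0) + dotp (sim1_adj u) z - dotp u z.
Proof. by rewrite -dotp_spiral0 /dotp /sim2 /=; field. Qed.

Lemma dotp_tail u n : dotp u (sim2 (spiral n.+1)) =
  (1 - q ^+ 2) * dotp u (spiral 0) - q * dotp u (spiral n).
Proof. by rewrite dotp_sim2E -dotp_spiralS dotp_spiral_rec; ring. Qed.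

(** A convex combination of S_1 and S_n. For n = 0 it involves S_0, which is not among the vertices;
    that case is the extra vertex X. *)
Lemma dotp_sim2_tail u n : dotp u (sim2 (sim2 (spiral n.+2))) =
  (1 - q ^+ 2) * dotp u (spiral 1) + q ^+ 2 * dotp u (spiral n).
Proof.
by rewrite dotp_sim2E !dotp_tail -!dotp_spiralS dotp_spiral_rec; ring.
Qed.
End SimilarityPair.

(** * Stability of the hull of finitely many spiral points *)

Section DragonHull.
Set Implicit Arguments.
Unset Strict Implicit.
Variables (R : realType) (t : R).
Implicit Types u z : R * R.
Hypotheses (t_neq0 : t != 0) (qlt1 : sqratio t < 1).
Local Notation q := (sqratio t).
Local Notation S := (spiral t).
Local Notation f1 := (sim1 t).
Local Notation f2 := (sim2 t).

Lemma sqratio_gt : 1 / 4 < q.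
Proof. by rewrite /sqratio ltrDl lt_def sqr_ge0 sqrf_eq0 t_neq0. Qed.

Definition vertices N : seq (R * R) :=
  [seq S i.+1 | i <- iota 0 N.+1] ++ [seq f2 (S i.+2) | i <- iota 0 N.+1] ++
  [:: f2 (f2 (S 2))].

(** The bound on both infinite spirals, on X, and at the limits 0 of S_n and 1 of T_n. *)
Definition spiral_bound u b := [/\ 0 <= b, u.1 <= b,
  forall k, dotp u (S k.+1) <= b,
  forall k, dotp u (f2 (S k.+2)) <= b & dotp u (f2 (f2 (S 2))) <= b].

(** [lin_rec_bound] is used once around 0, and once around 1 because T_(k+2) - 1 = - q S_(k+1) obeys
    the same recurrence. *)
Lemma vertices_bound : exists N, forall u b,
  (forall v, v \in vertices N -> dotp u v <= b) -> spiral_bound u b.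
Proof.
have [N hN] := @lin_rec_bound _ _ sqratio_gt qlt1; exists N => u b ub.
have [b0 Sb] : 0 <= b /\ forall k, dotp u (S (k + 1)) <= b.
  apply: (hN (fun k => dotp u (S (k + 1)))).
    exact: (lin_recS _ _ _ 1 (dotp_spiral_rec t u)).
  move=> i iN; apply: ub; rewrite mem_cat addn1.
  by rewrite (map_f (fun i => S i.+1)) // mem_iota add0n ltnS.
have [b1 Tb] : 0 <= b - u.1 /\ forall k, - (q * dotp u (S (k + 1))) <= b - u.1.
  apply: (hN (fun k => - (q * dotp u (S (k + 1))))).
    by move=> n; rewrite !addSn dotp_spiral_rec; ring.
  move=> i iN.
  have /ub : f2 (S i.+2) \in vertices N.
    rewrite !mem_cat; apply/orP; right; apply/orP; left.
    by rewrite (map_f (fun i => f2 (S i.+2))) // mem_iota add0n ltnS.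
  by rewrite dotp_tail // -dotp_spiral0 // addn1; lra.
split=> //; first by rewrite -subr_ge0.
- by move=> k; rewrite -addn1.
- by move=> k; have := Tb k; rewrite dotp_tail // -dotp_spiral0 // addn1; lra.
- by apply: ub; rewrite !mem_cat mem_head !orbT.
Qed.

Lemma spiral_bound_sim1 u b : spiral_bound u b ->
  [/\ forall k, dotp u (f1 (S k.+1)) <= b,
      forall k, dotp u (f1 (f2 (S k.+2))) <= b &
      dotp u (f1 (f2 (f2 (S 2)))) <= b].
Proof.
move=> [b0 _ Sb Tb _]; split=> [k|k|].
- exact: (Sb k.+1).
- rewrite dotp_sim1 dotp_tail // -!dotp_spiralS.
  apply: (lin_rec_corner _ _ _ _ _ sqratio_gt qlt1 (dotp_spiral_rec t u) b0 Sb).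
  by move=> j; rewrite -dotp_tail.
(* f1 X = (1 - q^2) S_2 + q^2 S_1. *)
- rewrite dotp_sim1 dotp_sim2_tail // -!dotp_spiralS.
  have /andP[q20 q21] : 0 <= q ^+ 2 <= 1.
    by rewrite sqr_ge0 expr_le1 ?ltW //; have := sqratio_gt; lra.
  have : 0 <= (1 - q ^+ 2) * (b - dotp u (S 2)).
    by apply: mulr_ge0; rewrite subr_ge0.
  have : 0 <= q ^+ 2 * (b - dotp u (S 1)).
    by apply: mulr_ge0; rewrite ?subr_ge0.
  lra.
Qed.

Lemma spiral_bound_sim2 u b : spiral_bound u b ->
  [/\ forall k, dotp u (f2 (S k.+1)) <= b,
      forall k, dotp u (f2 (f2 (S k.+2))) <= b &
      dotp u (f2 (f2 (f2 (S 2)))) <= b].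
Proof.
move=> [b0 u1b Sb Tb Xb].
have qgt := sqratio_gt; have qlt := qlt1.
have q0 : 0 < q by lra.
have q1 : 0 < 1 - q by lra.
have h := dotp_spiral_rec t u.
have h0 := h 0%N; have h1 := h 1%N.
have qe (x y : R) : 0 <= x -> y <= b -> 0 <= x * (b - y).
  by move=> x0 yb; rewrite mulr_ge0 // subr_ge0.
have qq : 0 <= q ^+ 2 by exact: sqr_ge0.
have qq1 : 0 <= 1 - q ^+ 2 by rewrite subr_ge0 expr_le1 ?ltW.
(* T_1 is not a vertex: it equals (1 - q - q^2) S_0, and lies between 0 and 1 when the factor is
   nonnegative. *)
have T1 : (1 - q - q ^+ 2) * dotp u (S 0) <= b.
  have [c0|c0] := leP 0 (1 - q - q ^+ 2).
    have [s0|s0] := leP (dotp u (S 0)) 0.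
      have : 0 <= (1 - q - q ^+ 2) * - dotp u (S 0) by rewrite mulr_ge0 // oppr_ge0.
      lra.
    have : 0 <= q * dotp u (S 0) by rewrite mulr_ge0 // ltW.
    move: u1b; rewrite (dotp_spiral0 qlt1); lra.
  have [s0|s0] := leP 0 (dotp u (S 0)).
    have : 0 <= - (1 - q - q ^+ 2) * dotp u (S 0) by rewrite mulr_ge0 // oppr_ge0 ltW.
    lra.
  (* Here [T1] lies between [0] and the point [q S3 + (1 - q) T2]. *)
  have := qe q _ (ltW q0) (Sb 2%N).
  have := qe (1 - q) _ (ltW q1) (Tb 0%N).
  rewrite dotp_tail // h1 h0.
  have : 0 <= q ^+ 2 * (1 - q) * - dotp u (S 0).
    by rewrite !mulr_ge0 ?oppr_ge0 ?ltW.
  lra.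
split=> [[|k]|[|k]|]; [|exact: Tb|exact: Xb| |].
- by move: T1; rewrite dotp_tail //; lra.
- rewrite dotp_sim2_tail //.
  have := qe _ _ qq1 (Sb 0%N); have := qe _ _ qq (Sb k); lra.
(* f2 X = (1 - q^2) T_1 + q^2 (1 - q) S_1 + q^3 S_2, with weights of sum 1. *)
- rewrite dotp_sim2E // dotp_sim2_tail // -!dotp_spiralS dotp_sim2_tail // h0.
  have := qe _ _ qq1 T1.
  have := qe _ _ (mulr_ge0 qq (ltW q1)) (Sb 0%N).
  have := qe _ _ (mulr_ge0 qq (ltW q0)) (Sb 1%N).
  rewrite h0; lra.
Qed.

Lemma vertices_stable : exists N, forall v, v \in vertices N ->
  halfplane_hull (vertices N) (f1 v) /\ halfplane_hull (vertices N) (f2 v).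
Proof.
have [N hN] := vertices_bound; exists N => v vV.
suff H u b : spiral_bound u b -> dotp u (f1 v) <= b /\ dotp u (f2 v) <= b.
  by split=> u b /hN /H[].
move=> ub; have [A1 A2 A3] := spiral_bound_sim1 ub.
have [B1 B2 B3] := spiral_bound_sim2 ub.
move: vV; rewrite !mem_cat => /or3P[/mapP[i _ ->]|/mapP[i _ ->]|].
- by split.
- by split.
- by rewrite inE => /eqP ->; split.
Qed.

(** * Compact invariant sets *)

Variable K : set (R * R).
Hypotheses (K_neq0 : K !=set0) (K_compact : compact K).
Hypothesis K_inv : K = (f1 @` K) `|` (f2 @` K).

Lemma inv_sim1 z : K z -> K (f1 z).
Proof. by move=> Kz; rewrite K_inv; left; exists z. Qed.

Lemma inv_sim2 z : K z -> K (f2 z).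
Proof. by move=> Kz; rewrite K_inv; right; exists z. Qed.

(* [spiral 1] is the attracting fixed point of [f2 f2 f1 f1]. *)
Lemma inv_spiral1 : K (S 1).
Proof.
have [z Kz] := K_neq0.
pose p n : R * R := ((S 1).1 + (q ^+ 2) ^+ n * (z.1 - (S 1).1),
                     (S 1).2 + (q ^+ 2) ^+ n * (z.2 - (S 1).2)).
have Kp n : K (p n).
  elim: n => [|n /inv_sim1/inv_sim1/inv_sim2/inv_sim2].
    by rewrite /p !expr0 !mul1r !subrKC -surjective_pairing.
  rewrite sim2_cycle; congr K; rewrite /p spiral1_eq [_ ^+ n.+1]exprS /=.
  move: (_ ^+ n) => X.
  by congr (_, _); field; exact: sqratio2_neq0.
have Kcl : closed K by apply: compact_closed => //; exact: norm_hausdorff.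
apply: (closed_cvg _ Kcl _ (S 1) (_ : p @ \oo --> S 1)); first exact: nearW.
have cvg0 (x y : R) : (fun n => x + (q ^+ 2) ^+ n * y) @ \oo --> x.
  have q2 : `|q ^+ 2| < 1.
    by rewrite ger0_norm ?sqr_ge0 // expr_lt1 //; have := sqratio_gt; lra.
  have := cvgD (cvg_cst x) (cvgM (cvg_expr q2) (cvg_cst y)).
  by rewrite mul0r addr0; apply.
rewrite [X in _ --> X]surjective_pairing.
exact: (cvg_pair (cvg0 (S 1).1 (z.1 - (S 1).1)) (cvg0 (S 1).2 (z.2 - (S 1).2))).
Qed.

Lemma inv_vertices N v : v \in vertices N -> K v.
Proof.
have KS n : K (S n.+1).
  by elim: n => [|n]; [exact: inv_spiral1|exact: inv_sim1].
rewrite !mem_cat => /or3P[/mapP[i _ ->]|/mapP[i _ ->]|].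
- exact: KS.
- exact/inv_sim2/KS.
- by rewrite inE => /eqP ->; do 2!apply: inv_sim2; exact: KS.
Qed.

(** A point of K is traced back through n preimages. Each replaces u by its image under an adjoint,
    shorter by the factor sqrt q, while stability of [l] preserves the bound on the vertices. *)
Lemma inv_sub_halfplane_hull l : l != [::] ->
  (forall v, v \in l -> halfplane_hull l (f1 v) /\ halfplane_hull l (f2 v)) ->
  K `<=` halfplane_hull l.
Proof.
case: l => // v0 l _; set l' := v0 :: l => stab.
have [M [Mreal KM]] := compact_bounded K_compact.
pose C := M + 1 + `|v0|.
have q0 : 0 < q by have := sqratio_gt; lra.
have C0 z : K z -> `|z.1 - v0.1| <= C /\ `|z.2 - v0.2| <= C.
  move=> /(KM (M + 1) (ltac:(by rewrite ltrDl))) => zM.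
  by split; apply: (le_trans (ler_normB _ _)); apply: lerD;
    rewrite ?(le_trans _ zM) // [leRHS]prod_normE le_max lexx ?orbT.
(* The excess over a halfplane shrinks with the norm of its normal. *)
have key n z u b (e : R) : K z -> 0 <= e -> u.1 ^+ 2 + u.2 ^+ 2 <= e ^+ 2 ->
    (forall v, v \in l' -> dotp u v <= b) ->
    dotp u z <= b + 2 * C * Num.sqrt q ^+ n * e.
  elim: n z u b e => [|n ih] z u b e Kz e0 ue ub.
    have [z1 z2] := C0 z Kz.
    have ule x : x ^+ 2 <= e ^+ 2 -> `|x| <= e.
      by move=> xe; rewrite -(ler_pXn2r (n := 2)) ?nnegrE // real_normK // num_real.
    have u1 : `|u.1| <= e by apply: ule; have := sqr_ge0 u.2; lra.
    have u2 : `|u.2| <= e by apply: ule; have := sqr_ge0 u.1; lra.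
    have := ub v0 (mem_head _ _).
    have : u.1 * (z.1 - v0.1) <= e * C.
      by rewrite (le_trans (ler_norm _)) // normrM ler_pM.
    have : u.2 * (z.2 - v0.2) <= e * C.
      by rewrite (le_trans (ler_norm _)) // normrM ler_pM.
    by rewrite /dotp expr0; lra.
  have se : 0 <= Num.sqrt q * e by rewrite mulr_ge0 // sqrtr_ge0.
  have sE : (Num.sqrt q * e) ^+ 2 = q * e ^+ 2 by rewrite exprMn sqr_sqrtr // ltW.
  have qe : q * (u.1 ^+ 2 + u.2 ^+ 2) <= q * e ^+ 2 by rewrite ler_pM2l.
  move: Kz; rewrite K_inv => -[] [y Ky <-].
    have := ih y (sim1_adj t u) b _ Ky se; rewrite sE dotp_sim1 => H.
    have : dotp (sim1_adj t u) y <= b + 2 * C * Num.sqrt q ^+ n * (Num.sqrt q * e).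
      apply: H.
      - by apply: le_trans qe; rewrite /sqratio /sim1_adj /=; lra.
      - by move=> v /stab[vl _]; rewrite -dotp_sim1; exact: vl.
    by rewrite [_ ^+ n.+1]exprSr !mulrA.
  have := ih y (sim2_adj t u) (b - u.1) _ Ky se; rewrite sE dotp_sim2 => H.
  have : dotp (sim2_adj t u) y <= b - u.1 + 2 * C * Num.sqrt q ^+ n * (Num.sqrt q * e).
    apply: H.
    - by apply: le_trans qe; rewrite /sqratio /sim2_adj /=; lra.
    - move=> v /stab[_ vl]; rewrite lerBrDl -dotp_sim2; exact: vl.
  by rewrite [_ ^+ n.+1]exprSr !mulrA; lra.
move=> z Kz u b ub.
pose e := Num.sqrt (u.1 ^+ 2 + u.2 ^+ 2).
have e2 : u.1 ^+ 2 + u.2 ^+ 2 <= e ^+ 2.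
  by rewrite sqr_sqrtr // addr_ge0 // sqr_ge0.
have lim : (fun n => b + 2 * C * Num.sqrt q ^+ n * e) @ \oo --> b.
  have sq1 : `|Num.sqrt q| < 1.
    by rewrite ger0_norm ?sqrtr_ge0 // -[ltRHS]sqrtr1 ltr_sqrt.
  have := cvgD (cvg_cst b)
    (cvgM (cvgM (cvg_cst (2 * C)) (cvg_expr sq1)) (cvg_cst e)).
  by rewrite mulr0 mul0r addr0; apply.
rewrite -(cvg_lim _ lim) //; apply: limr_ge; first by apply/cvg_ex; exists b.
by apply: nearW => n; apply: key => //; exact: sqrtr_ge0.
Qed.

Lemma inv_hull_polygon : is_polygon (convex_hull K).
Proof.
have [N stab] := vertices_stable; exists (vertices N).
apply/seteqP; split=> z.
  move=> Kz; apply: halfplane_hull_sub_convex_hull.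
  apply: convex_hull_sub_halfplane_hull Kz.
  exact: inv_sub_halfplane_hull.
by apply: sub_convex_hull => v; exact: inv_vertices.
Qed.
End DragonHull.

(** * Application to the dragon curve *)

Lemma cos_pi3 (R : realType) : cos (pi / 3) = 1 / 2 :> R.
Proof.
set x : R := pi / 3; have p0 := pi_gt0 R.
have c0 : 0 < cos x by apply: cos_gt0_pihalf; rewrite /x; lra.
have : cos (x *+ 2 + x) = - 1.
  by rewrite -cospi; congr cos; rewrite /x; field.
have s2 := sin2cos2 x.
rewrite cosD cos_mulr2n sin_mulr2n => h.
(* The triple angle formula turns cos 3x = -1 into 4 c^3 - 3 c + 1 = 0, which factors. *)
have : (cos x + 1) * (2 * cos x - 1) ^+ 2 = 0.
  have : (cos x * sin x) *+ 2 * sin x = (cos x * sin x ^+ 2) *+ 2 by ring.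
  rewrite s2 => e; move: h; rewrite e; lra.
by move=> /eqP; rewrite mulf_eq0 sqrf_eq0 => /orP[] /eqP; lra.
Qed.

Theorem theorem1p2 (R : realType) (eta : R) (K : set (R * R)) :
  0 < eta -> eta < pi / 3 ->
  K !=set0 -> compact K ->
  K = (dragon_f1 eta @` K) `|` (dragon_f2 eta @` K) ->
  is_polygon (convex_hull K).
Proof.
move=> eta0 eta3 K0 cK Kinv; have p0 := pi_gt0 R.
have c2 : 1 / 2 < cos eta.
  by rewrite -cos_pi3 ltr_cos // in_itv /=; lra.
have s0 : 0 < sin eta by apply: sin_gt0_pi; lra.
have c_neq0 : cos eta != 0 by rewrite gt_eqF //; lra.
pose t := sin eta / (2 * cos eta).
have t_neq0 : t != 0 by rewrite gt_eqF // divr_gt0 //; lra.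
have qE : sqratio t = (4 * cos eta ^+ 2)^-1.
  have -> : sqratio t = (cos eta ^+ 2 + sin eta ^+ 2) / (4 * cos eta ^+ 2).
    by rewrite /sqratio /t; field.
  by rewrite cos2Dsin2 mul1r.
(* Here eta < pi/3 enters: q < 1 amounts to cos eta > 1/2. *)
have qlt1 : sqratio t < 1.
  by rewrite qE invf_lt1; nra.
have f1E : dragon_f1 eta = sim1 t.
  apply/funext => z; rewrite /dragon_f1 /cmul /dragon_a /sim1 /t /=.
  by congr (_, _); field.
have f2E : dragon_f2 eta = sim2 t.
  apply/funext => z; rewrite /dragon_f2 /cmul /cconj /dragon_a /sim2 /t /=.
  by congr (_, _); field.
rewrite f1E f2E in Kinv.
exact: (inv_hull_polygon t_neq0 qlt1 K0 cK Kinv).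
Qed.
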